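(* Let $\lambda_0,\lambda_1,\lambda_2,\lambda_3\in\mathbb{C}$, $n\ge 3$, and $t_1<\dots<t_n$ be real numbers such that $\Phi_{(\lambda_0,\lambda_1)}(t_{j+1}-t_j)\neq 0$ and $\Phi_{(\lambda_2,\lambda_3)}(t_{j+1}-t_j)\neq 0$ for $j=1,\dots,n-1$. Then the entries of the tridiagonal matrix $R=(R_{i,j})_{2\le i,j\le n-1}$ defined in the context are given by $$R_{j,j}=\rho(t_j-t_{j-1})-\rho(-(t_{j+1}-t_j)),$$ $$R_{j,j+1}=\sigma(t_{j+1}-t_j)\quad\text{and}\quad R_{j+1,j}=-\sigma(-(t_{j+1}-t_j)).$$
   Context: For $(\mu_0,\dots,\mu_N)\in\mathbb{C}^{N+1}$ let $E(\mu_0,\dots,\mu_N)$ be the space of functions $f:\mathbb{R}\to\mathbb{C}$ with $\prod_{j=0}^N(\frac{d}{dx}-\mu_j)f=0$, and let $\Phi_{(\mu_0,\dots,\mu_N)}$ (the fundamental function) be the unique element of this space with $\Phi^{(k)}(0)=0$ for $k=0,\dots,N-1$ and $\Phi^{(N)}(0)=1$. Put $L_1=(\frac{d}{dt}-\lambda_0)(\frac{d}{dt}-\lambda_1)$. For $j=1,\dots,n-1$, $A^{[1]}_j,B^{[1]}_j$ are the unique elements of $E(\lambda_0,\lambda_1,\lambda_2,\lambda_3)$ with $A^{[1]}_j(t_j)=A^{[1]}_j(t_{j+1})=0$, $L_1A^{[1]}_j(t_j)=1$, $L_1A^{[1]}_j(t_{j+1})=0$, and $B^{[1]}_j(t_j)=B^{[1]}_j(t_{j+1})=0$,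 $L_1B^{[1]}_j(t_j)=0$, $L_1B^{[1]}_j(t_{j+1})=1$ (existence and uniqueness hold under the stated non-vanishing assumptions). The tridiagonal $(n-2)\times(n-2)$ matrix $R=(R_{i,j})_{2\le i,j\le n-1}$ (the matrix with $Q^T\mathbf g=R\gamma$ for natural $L$-splines) is defined by $$R_{j,j}=\frac{dB^{[1]}_{j-1}}{dt}(t_j)-\frac{dA^{[1]}_{j}}{dt}(t_j),\quad R_{j,j+1}=-\frac{dB^{[1]}_{j}}{dt}(t_j),\quad R_{j,j-1}=\frac{dA^{[1]}_{j-1}}{dt}(t_j).$$ The functions $\rho,\sigma$ are defined, wherever the denominators do not vanish, by $$\rho(x)=\frac{\Phi'_{(\lambda_0,\dots,\lambda_3)}(x)\Phi_{(\lambda_0,\lambda_1)}(x)-\Phi_{(\lambda_0,\dots,\lambda_3)}(x)\Phi'_{(\lambda_0,\lambda_1)}(x)}{\Phi_{(\lambda_0,\lambda_1)}(x)\Phi_{(\lambda_2,\lambda_3)}(x)},\qquad \sigma(x)=\frac{\Phi_{(\lambda_0,\dots,\lambda_3)}(x)}{\Phi_{(\lambda_0,\lambda_1)}(x)\Phi_{(\lambda_2,\lambda_3)}(x)}.$$ *)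

(* Defs.v *)
(* Stdlib reals with Coquelicot; [C] is Coquelicot's type of complex numbers. *)
From Stdlib Require Import Reals List Arith ClassicalEpsilon.
From Coquelicot Require Import Coquelicot.
Import ListNotations.
Local Open Scope C_scope.

(* Coquelicot's total [Derive] is real-valued, so it is applied to the real and
   imaginary parts.  The value means [f'(x)] only where [f] is differentiable. *)
Definition Cderiv (f : R -> C) : R -> C :=
  fun x => (Derive (fun s => Re (f s)) x, Derive (fun s => Im (f s)) x).

Definition Cderiv_n (k : nat) (f : R -> C) : R -> C := Nat.iter k Cderiv f.

Definition differentiable (f : R -> C) : Prop :=
  forall x : R, @ex_derive R_AbsRing C_R_NormedModule f x.

(* [diffop [mu_0; ...; mu_N]] is (d/dx - mu_0) ... (d/dx - mu_N). *)
Definition diffop (mu : list C) (f : R -> C) : R -> C :=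
  fold_right (fun m g x => Cderiv g x - m * g x) f mu.

(* The first clause says that [f] is [length mu] times differentiable: without
   it [diffop mu f] would be built from junk values of [Derive]. *)
Definition Espace (mu : list C) (f : R -> C) : Prop :=
  (forall k : nat, (k < length mu)%nat -> differentiable (Cderiv_n k f)) /\
  (forall x : R, diffop mu f x = 0).

(* The unique function with property [P]; unspecified if there is no such
   function or more than one. *)
Definition the_fun (P : (R -> C) -> Prop) : R -> C :=
  epsilon (inhabits (fun _ : R => RtoC 0)) (unique P).

(* For mu = [mu_0; ...; mu_N], [length mu] is N + 1. *)
Definition is_fundamental (mu : list C) (f : R -> C) : Prop :=
  Espace mu f /\
  (forall k : nat, (S k < length mu)%nat -> Cderiv_n k f 0%R = 0) /\
  Cderiv_n (pred (length mu)) f 0%R = 1.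

Definition Phi (mu : list C) : R -> C := the_fun (is_fundamental mu).

Definition L_one (l0 l1 : C) : (R -> C) -> R -> C := diffop [l0; l1].

(* The points t_1 < ... < t_n are [t 1], ..., [t n]; other values of [t] are
   irrelevant. *)
Definition A_one (l0 l1 l2 l3 : C) (t : nat -> R) (j : nat) : R -> C :=
  the_fun (fun f => Espace [l0; l1; l2; l3] f /\
                f (t j) = 0 /\ f (t (j + 1)%nat) = 0 /\
                L_one l0 l1 f (t j) = 1 /\ L_one l0 l1 f (t (j + 1)%nat) = 0).

Definition B_one (l0 l1 l2 l3 : C) (t : nat -> R) (j : nat) : R -> C :=
  the_fun (fun f => Espace [l0; l1; l2; l3] f /\
                f (t j) = 0 /\ f (t (j + 1)%nat) = 0 /\
                L_one l0 l1 f (t j) = 0 /\ L_one l0 l1 f (t (j + 1)%nat) = 1).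

Definition Rcoef (l0 l1 l2 l3 : C) (t : nat -> R) (i j : nat) : C :=
  if Nat.eqb j i then
    Cderiv (B_one l0 l1 l2 l3 t (i - 1)) (t i) - Cderiv (A_one l0 l1 l2 l3 t i) (t i)
  else if Nat.eqb j (i + 1) then - Cderiv (B_one l0 l1 l2 l3 t i) (t i)
  else if Nat.eqb (j + 1) i then Cderiv (A_one l0 l1 l2 l3 t (i - 1)) (t i)
  else 0.

(* Coquelicot matrices are indexed from 0 while the rows and columns of R are
   numbered 2, ..., n - 1; [Rentry] restores that numbering. *)
Definition Rmat (l0 l1 l2 l3 : C) (n : nat) (t : nat -> R) :
    matrix (T := C) (n - 2) (n - 2) :=
  mk_matrix (n - 2) (n - 2)
    (fun i j => Rcoef l0 l1 l2 l3 t (i + 2) (j + 2)).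

Definition Rentry (l0 l1 l2 l3 : C) (n : nat) (t : nat -> R) (i j : nat) : C :=
  coeff_mat (RtoC 0) (Rmat l0 l1 l2 l3 n t) (i - 2) (j - 2).

(* Meaningful only where the denominators do not vanish, as division in [C] is
   total. *)
Definition rho_L (l0 l1 l2 l3 : C) (x : R) : C :=
  (Cderiv (Phi [l0; l1; l2; l3]) x * Phi [l0; l1] x
   - Phi [l0; l1; l2; l3] x * Cderiv (Phi [l0; l1]) x)
  / (Phi [l0; l1] x * Phi [l2; l3] x).

Definition sigma_L (l0 l1 l2 l3 : C) (x : R) : C :=
  Phi [l0; l1; l2; l3] x / (Phi [l0; l1] x * Phi [l2; l3] x).

(* Main.v *)
Require Import Defs.
From Stdlib Require Import Reals List.
From Coquelicot Require Import Coquelicot.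
From Stdlib Require Import Lia Lra Permutation ClassicalEpsilon FunctionalExtensionality.
Import ListNotations.
Local Open Scope C_scope.

(** Write D_m for d/dx - m, L_1 = D_l0 D_l1, Phi4 for the fundamental function
    of (l0, l1, l2, l3), and Phi01, Phi23 for those of (l0, l1), (l2, l3).
    The functions A_j and B_j are two instances of one object: given points
    p and q, in either order, let f be the element of E(l0, l1, l2, l3) with
    f(p) = f(q) = 0, L_1 f(p) = 0 and L_1 f(q) = 1.  Then B_j is f for
    (p, q) = (t_j, t_{j+1}) and A_j is f for (p, q) = (t_{j+1}, t_j), which is
    why the entries of R involve rho and sigma at both signs of the step.

    With h = q - p, the function f has the closed form
      f(x) = Phi4(x - p) / Phi23(h) - sigma(h) Phi01(x - p).
    Indeed L_1 Phi01 = 0, while L_1 Phi4 = Phi23 ([diffop_Phi_app]): applying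
    D_m to a fundamental function removes m from its list of exponents.  So
    L_1 f(x) = Phi23(x - p) / Phi23(h), which is 0 at p and 1 at q, and the
    coefficient sigma(h) is what makes f(q) vanish.  As Phi4 has a zero of order
    3 at 0 and Phi01'(0) = 1, it follows that f'(p) = - sigma(h), and computing
    f'(q) gives rho(h) ([boundary_data_exists]).

    For uniqueness, the difference d of two candidates has L_1 d in E(l2, l3)
    with zeros at p and q.  An element of E(a, b) with a zero at p is a multiple
    of Phi_(a,b)(x - p), so a second zero where this does not vanish forces it
    to be zero ([two_point_unique]).  Hence L_1 d = 0, so d lies in E(l0, l1),
    and the same argument gives d = 0.  The same fact shows that
    Phi_(a,b)(h) <> 0 implies Phi_(a,b)(-h) <> 0 ([Phi_pair_opp]), as needed for
    A_j.

    What remains is the general theory of E(mu): the factors D_m commute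
    ([diffop_perm]), elements of E(mu) are infinitely differentiable
    ([Espace_smooth]) and determined by their initial data
    ([Espace_initial_unique]), and fundamental functions exist
    ([is_fundamental_exists]).  Each follows by removing or adding the innermost
    factor of the product, which reduces it to the scalar equation
    f' = m f + g, solved with a complex exponential as integrating factor. *)

(** * Derivatives of complex-valued functions of a real variable *)

(** [ring] recognizes [C] only when the type of the equation is syntactically
    [C], and not a carrier of some normed module or a product. *)
Ltac Cring := match goal with |- @eq _ ?a ?b => change (@eq C a b) end; ring.

Definition has_Cderiv (f : R -> C) (x : R) (l : C) : Prop :=
  @is_derive R_AbsRing C_R_NormedModule f x l.

(** The bridge between the two notions of derivative in use: [Cderiv] is
    defined by components, differentiability in the normed module. *)
Lemma has_Cderiv_components f x l :
  has_Cderiv f x l <->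
  is_derive (fun s => Re (f s)) x (Re l) /\ is_derive (fun s => Im (f s)) x (Im l).
Proof.
  split.
  - intros H; split.
    + refine (filterdiff_ext_lin _ _ _
        (filterdiff_comp f (fun z : C_R_NormedModule => fst z) _ fst H
           (filterdiff_linear _ is_linear_fst)) _).
      reflexivity.
    + refine (filterdiff_ext_lin _ _ _
        (filterdiff_comp f (fun z : C_R_NormedModule => snd z) _ snd H
           (filterdiff_linear _ is_linear_snd)) _).
      reflexivity.
  - intros [H1 H2].
    (* f is recovered as Re f times 1 plus Im f times i. *)
    pose proof (is_derive_scal_l (V := C_R_NormedModule) _ _ _ (RtoC 1) H1) as K1.
    pose proof (is_derive_scal_l (V := C_R_NormedModule) _ _ _ Ci H2) as K2.
    pose proof (is_derive_plus _ _ _ _ _ K1 K2) as K.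
    replace l with (@plus C_R_NormedModule
       (@scal R_AbsRing C_R_NormedModule (Re l) (RtoC 1))
       (@scal R_AbsRing C_R_NormedModule (Im l) Ci)).
    + refine (is_derive_ext _ _ _ _ _ K).
      intros s; destruct (f s) as [a b]; cbv; f_equal; ring.
    + destruct l as [a b]; cbv; f_equal; ring.
Qed.

Lemma has_Cderiv_eq f x l l' : has_Cderiv f x l -> l = l' -> has_Cderiv f x l'.
Proof. intros H <-; exact H. Qed.

Lemma has_Cderiv_unique f x l : has_Cderiv f x l -> Cderiv f x = l.
Proof.
  intros H; apply has_Cderiv_components in H; destruct H as [H1 H2].
  unfold Cderiv. destruct l as [a b].
  f_equal; apply is_derive_unique; assumption.
Qed.

Lemma differentiable_has_Cderiv f x : differentiable f -> has_Cderiv f x (Cderiv f x).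
Proof.
  intros H; destruct (H x) as [l Hl].
  rewrite (has_Cderiv_unique _ _ _ Hl); exact Hl.
Qed.

(** How an explicit derivative is turned into an equation between functions, the
    form needed to compute iterated derivatives by rewriting. *)
Lemma Cderiv_char f g :
  (forall x, has_Cderiv f x (g x)) -> differentiable f /\ Cderiv f = g.
Proof.
  intros H; split.
  - intros x; exists (g x); apply H.
  - apply functional_extensionality; intros x; apply has_Cderiv_unique, H.
Qed.

Lemma has_Cderiv_mult f g x a b :
  has_Cderiv f x a -> has_Cderiv g x b ->
  has_Cderiv (fun s => f s * g s) x (a * g x + f x * b).
Proof.
  intros Hf Hg; apply has_Cderiv_components in Hf, Hg; apply has_Cderiv_components.
  destruct Hf as [f1 f2], Hg as [g1 g2].
  assert (Hc : forall n m : R, mult n m = mult m n) by (intros; apply Rmult_comm).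
  split; simpl.
  - pose proof (is_derive_minus _ _ _ _ _ (is_derive_mult _ _ _ _ _ f1 g1 Hc)
                  (is_derive_mult _ _ _ _ _ f2 g2 Hc)) as K.
    evar_last; [exact K|]. unfold minus, plus, opp, mult; simpl; unfold Re, Im; ring.
  - pose proof (is_derive_plus _ _ _ _ _ (is_derive_mult _ _ _ _ _ f1 g2 Hc)
                  (is_derive_mult _ _ _ _ _ f2 g1 Hc)) as K.
    evar_last; [exact K|]. unfold minus, plus, opp, mult; simpl; unfold Re, Im; ring.
Qed.

Lemma has_Cderiv_const (c : C) x : has_Cderiv (fun _ => c) x 0.
Proof. apply has_Cderiv_components; split; apply (is_derive_const (V := R_NormedModule)). Qed.

Lemma has_Cderiv_lin f g c x a b :
  has_Cderiv f x a -> has_Cderiv g x b ->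
  has_Cderiv (fun s => f s + c * g s) x (a + c * b).
Proof.
  intros Hf Hg.
  eapply has_Cderiv_eq.
  - exact (is_derive_plus _ _ _ _ _ Hf
      (has_Cderiv_mult _ _ _ _ _ (has_Cderiv_const c x) Hg)).
  - change (a + (0 * g x + c * b) = a + c * b); Cring.
Qed.

Lemma has_Cderiv_shift f p x l :
  has_Cderiv f (x - p)%R l -> has_Cderiv (fun s => f (s - p)%R) x l.
Proof.
  intros H.
  pose proof (is_derive_comp (V := C_R_NormedModule) f (fun s : R => (s - p)%R) x l 1%R H) as K.
  eapply has_Cderiv_eq.
  - apply K. auto_derive; [trivial | ring].
  - unfold scal; simpl. destruct l; cbv; f_equal; ring.
Qed.

(** * First-order linear equations *)

(** The function exp (m x), for complex m and real x. *)
Definition cexp (m : C) (x : R) : C :=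
  ((exp (Re m * x) * cos (Im m * x))%R, (exp (Re m * x) * sin (Im m * x))%R).

Lemma has_Cderiv_cexp m x : has_Cderiv (cexp m) x (m * cexp m x).
Proof.
  apply has_Cderiv_components; split; simpl; auto_derive; trivial; unfold Re, Im; ring.
Qed.

Lemma cexp_opp m x : cexp m x * cexp (- m) x = 1.
Proof.
  unfold cexp, Cmult, Copp, Re, Im, RtoC; simpl.
  replace (- fst m * x)%R with (- (fst m * x))%R by ring.
  replace (- snd m * x)%R with (- (snd m * x))%R by ring.
  rewrite cos_neg, sin_neg, exp_Ropp.
  pose proof (sin2_cos2 (snd m * x)) as Hs; unfold Rsqr in Hs.
  pose proof (exp_pos (fst m * x)) as He.
  f_equal; [|ring].
  field_simplify; [|lra]. nra.
Qed.

Lemma cexp_0 m : cexp m 0%R = 1.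
Proof. unfold cexp; rewrite !Rmult_0_r, exp_0, cos_0, sin_0. apply injective_projections; simpl; ring. Qed.

Lemma zero_Cderiv_const f : (forall x, has_Cderiv f x 0) -> forall x y, f x = f y.
Proof.
  intros H x y.
  destruct (Rtotal_order x y) as [h | [-> | h]]; [| reflexivity |].
  - apply (eq_is_derive (V := C_R_NormedModule) f x y); [intros; apply H | exact h].
  - symmetry; apply (eq_is_derive (V := C_R_NormedModule) f y x); [intros; apply H | exact h].
Qed.

(** The product of f with the integrating factor exp (- m x) has derivative 0. *)
Lemma first_order_unique m f :
  (forall x, has_Cderiv f x (m * f x)) -> f 0%R = 0 -> f = (fun _ => 0).
Proof.
  intros H H0; apply functional_extensionality; intros x.
  assert (K : f x * cexp (- m) x = f 0%R * cexp (- m) 0%R).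
  { apply (zero_Cderiv_const (fun s => f s * cexp (- m) s)); intros s.
    eapply has_Cderiv_eq; [apply has_Cderiv_mult; [apply H | apply has_Cderiv_cexp] | Cring]. }
  rewrite H0 in K.
  replace (f x) with (f x * cexp (- m) x * cexp m x).
  - rewrite K; Cring.
  - rewrite <- Cmult_assoc, (Cmult_comm (cexp (- m) x)), cexp_opp; Cring.
Qed.

(** Variation of constants: f(x) = e^(m x) (c + int_0^x e^(- m s) g(s) ds). *)
Lemma first_order_exists m c g :
  differentiable g ->
  exists f, (forall x, has_Cderiv f x (m * f x + g x)) /\ f 0%R = c.
Proof.
  intros Hg.
  set (w := fun s : R => cexp (- m) s * g s).
  set (W := fun x : R => RInt (V := C_R_CompleteNormedModule) w 0%R x).
  assert (Hw : forall x, @continuous R_UniformSpace C_R_CompleteNormedModule w x).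
  { intros x.
    apply (ex_derive_continuous (V := C_R_NormedModule) w x).
    eexists; apply has_Cderiv_mult;
      [apply has_Cderiv_cexp | apply differentiable_has_Cderiv, Hg]. }
  assert (HW : forall x, has_Cderiv W x (w x)).
  { intros x; apply (is_derive_RInt (V := C_R_CompleteNormedModule) w W 0%R x); [|apply Hw].
    apply filter_forall; intros y; apply RInt_correct, ex_RInt_continuous.
    intros z _; apply Hw. }
  exists (fun x => cexp m x * (c + 1 * W x)); split.
  - intros x; eapply has_Cderiv_eq.
    + apply has_Cderiv_mult; [apply has_Cderiv_cexp|].
      apply has_Cderiv_lin; [apply has_Cderiv_const | apply HW].
    + unfold w.
      transitivity (m * (cexp m x * (c + 1 * W x)) + (cexp m x * cexp (- m) x) * g x); [Cring|].
      rewrite cexp_opp; Cring.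
  - unfold W; rewrite RInt_point, cexp_0. change (@zero C_R_CompleteNormedModule) with (RtoC 0). Cring.
Qed.

(** * Iterated derivatives and products of first-order operators *)

(** The regularity clause of [Espace], with the order freed from [length mu]. *)
Definition smooth (n : nat) (f : R -> C) : Prop :=
  forall k : nat, (k < n)%nat -> differentiable (Cderiv_n k f).

Lemma Cderiv_n_S k f : Cderiv_n (S k) f = Cderiv_n k (Cderiv f).
Proof. apply Nat.iter_succ_r. Qed.

(** Peeling off the first derivative instead of the last one lets regularity be
    proved by induction with the function generalized. *)
Lemma smooth_S n f : smooth (S n) f <-> differentiable f /\ smooth n (Cderiv f).
Proof.
  split.
  - intros H; split; [apply (H 0%nat); lia|].
    intros k hk; rewrite <- Cderiv_n_S; apply H; lia.
  - intros [H0 H] [|k] hk; [exact H0|].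
    rewrite Cderiv_n_S; apply H; lia.
Qed.

Lemma smooth_le n m f : (m <= n)%nat -> smooth n f -> smooth m f.
Proof. intros h H k hk; apply H; lia. Qed.

Lemma smooth_0 f : smooth 0 f.
Proof. intros k hk; lia. Qed.

Lemma smooth_const c n : smooth n (fun _ => c).
Proof.
  revert c; induction n as [|n IH]; intros c; [apply smooth_0|].
  destruct (Cderiv_char (fun _ => c) (fun _ => 0)) as [H1 H2].
  { intros x; apply has_Cderiv_const. }
  apply smooth_S; split; [exact H1|]. rewrite H2; apply IH.
Qed.

Lemma Cderiv_lin f g c : differentiable f -> differentiable g ->
  differentiable (fun x => f x + c * g x) /\
  Cderiv (fun x => f x + c * g x) = (fun x => Cderiv f x + c * Cderiv g x).
Proof.
  intros Hf Hg; apply Cderiv_char; intros x.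
  apply has_Cderiv_lin; apply differentiable_has_Cderiv; assumption.
Qed.

Lemma smooth_lin n f g c :
  smooth n f -> smooth n g -> smooth n (fun x => f x + c * g x).
Proof.
  revert f g; induction n as [|n IH]; intros f g Hf Hg; [apply smooth_0|].
  apply smooth_S in Hf, Hg. destruct Hf as [f0 Hf], Hg as [g0 Hg].
  destruct (Cderiv_lin f g c f0 g0) as [H1 H2].
  apply smooth_S; split; [exact H1|]. rewrite H2; apply IH; assumption.
Qed.

Lemma Cderiv_n_lin n f g c : smooth n f -> smooth n g ->
  Cderiv_n n (fun x => f x + c * g x) = (fun x => Cderiv_n n f x + c * Cderiv_n n g x).
Proof.
  revert f g; induction n as [|n IH]; intros f g Hf Hg; [reflexivity|].
  apply smooth_S in Hf, Hg. destruct Hf as [f0 Hf], Hg as [g0 Hg].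
  rewrite !Cderiv_n_S. destruct (Cderiv_lin f g c f0 g0) as [_ ->]. apply IH; assumption.
Qed.

Lemma Cderiv_shift f p : differentiable f ->
  differentiable (fun x => f (x - p)%R) /\
  Cderiv (fun x => f (x - p)%R) = (fun x => Cderiv f (x - p)%R).
Proof.
  intros Hf; apply Cderiv_char; intros x.
  apply has_Cderiv_shift, differentiable_has_Cderiv, Hf.
Qed.

Lemma smooth_shift n f p : smooth n f -> smooth n (fun x => f (x - p)%R).
Proof.
  revert f; induction n as [|n IH]; intros f Hf; [apply smooth_0|].
  apply smooth_S in Hf; destruct Hf as [f0 Hf].
  destruct (Cderiv_shift f p f0) as [H1 H2].
  apply smooth_S; split; [exact H1|]. rewrite H2; apply (IH (Cderiv f)), Hf.
Qed.

Lemma diffop_cons m mu f : diffop (m :: mu) f = diffop [m] (diffop mu f).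
Proof. reflexivity. Qed.

Lemma diffop_app mu nu f : diffop (mu ++ nu) f = diffop mu (diffop nu f).
Proof. unfold diffop; apply fold_right_app. Qed.

(** Written with [+ - m *] so that the linearity lemmas apply to D_m f itself. *)
Lemma diffop_single m f : diffop [m] f = (fun x => Cderiv f x + - m * f x).
Proof. apply functional_extensionality; intros x; simpl; Cring. Qed.

Lemma smooth_diffop mu n f : smooth (length mu + n) f -> smooth n (diffop mu f).
Proof.
  revert n; induction mu as [|m mu IH]; intros n H; [exact H|].
  rewrite diffop_cons, diffop_single.
  assert (K : smooth (S n) (diffop mu f)).
  { apply IH; eapply smooth_le; [|exact H]; simpl; lia. }
  apply smooth_lin; [apply smooth_S, K | eapply smooth_le; [|exact K]; lia].
Qed.

Lemma differentiable_diffop mu f : smooth (S (length mu)) f -> differentiable (diffop mu f).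
Proof.
  intros H; refine (smooth_diffop mu 1 f _ 0%nat _); [|lia].
  eapply smooth_le; [|exact H]; lia.
Qed.

Lemma diffop_lin mu f g c : smooth (length mu) f -> smooth (length mu) g ->
  diffop mu (fun x => f x + c * g x) = (fun x => diffop mu f x + c * diffop mu g x).
Proof.
  induction mu as [|m mu IH]; intros Hf Hg; [reflexivity|].
  rewrite !(diffop_cons m mu), IH;
    try (eapply smooth_le; [|eassumption]; simpl; lia).
  rewrite !diffop_single.
  destruct (Cderiv_lin (diffop mu f) (diffop mu g) c) as [_ ->];
    try (apply differentiable_diffop; assumption).
  apply functional_extensionality; intros x; Cring.
Qed.

Lemma diffop_shift mu f p : smooth (length mu) f ->
  diffop mu (fun x => f (x - p)%R) = (fun x => diffop mu f (x - p)%R).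
Proof.
  induction mu as [|m mu IH]; intros Hf; [reflexivity|].
  rewrite !(diffop_cons m mu), IH;
    try (eapply smooth_le; [|eassumption]; simpl; lia).
  rewrite !diffop_single.
  destruct (Cderiv_shift (diffop mu f) p) as [_ ->];
    [apply differentiable_diffop; assumption | reflexivity].
Qed.

(** Regularity is needed because swapping two factors compares two expressions
    in the second derivative: D_a D_b g = g'' - (a + b) g' + a b g. *)
Lemma diffop_perm mu nu f : Permutation mu nu -> smooth (length mu) f ->
  diffop mu f = diffop nu f.
Proof.
  induction 1 as [|m mu nu _ IH|a b mu|mu nu xi H IH _ IH']; intros Hf.
  - reflexivity.
  - rewrite (diffop_cons m mu), (diffop_cons m nu), IH; [reflexivity|].
    eapply smooth_le; [|eassumption]; simpl; lia.
  - rewrite (diffop_cons b (a :: mu)), (diffop_cons a (b :: mu)), (diffop_cons a mu),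
      (diffop_cons b mu), !diffop_single.
    assert (K : smooth 2 (diffop mu f)).
    { apply smooth_diffop; eapply smooth_le; [|exact Hf]; simpl; lia. }
    apply smooth_S in K; destruct K as [K0 K]; apply smooth_S in K; destruct K as [K1 _].
    destruct (Cderiv_lin _ _ (- a) K1 K0) as [_ ->].
    destruct (Cderiv_lin _ _ (- b) K1 K0) as [_ ->].
    apply functional_extensionality; intros x; Cring.
  - rewrite IH by exact Hf. apply IH'. rewrite <- (Permutation_length H); exact Hf.
Qed.

(** * The spaces E(mu) *)

Lemma Espace_perm mu nu f : Permutation mu nu -> Espace mu f -> Espace nu f.
Proof.
  intros H [Hs Hd]; split.
  - rewrite <- (Permutation_length H); exact Hs.
  - rewrite <- (diffop_perm mu nu f H Hs); exact Hd.
Qed.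

Lemma Espace_lin mu f g c :
  Espace mu f -> Espace mu g -> Espace mu (fun x => f x + c * g x).
Proof.
  intros [Hf Ef] [Hg Eg]; split.
  - apply smooth_lin; assumption.
  - intros x; rewrite diffop_lin by assumption. rewrite Ef, Eg; Cring.
Qed.

Lemma Espace_shift mu f p : Espace mu f -> Espace mu (fun x => f (x - p)%R).
Proof.
  intros [Hf Ef]; split.
  - exact (smooth_shift _ f p Hf).
  - intros x; rewrite diffop_shift by exact Hf. apply Ef.
Qed.

Lemma Espace_diffop mu nu f : Espace (mu ++ nu) f -> Espace mu (diffop nu f).
Proof.
  intros [Hf Ef]; split.
  - apply smooth_diffop; eapply smooth_le; [|exact Hf]; rewrite length_app; lia.
  - rewrite <- diffop_app; exact Ef.
Qed.

(** Since f' = D_m f + m f, the function f has one more derivative than D_m f. *)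
Lemma smooth_of_diffop m n f :
  differentiable f -> smooth n (diffop [m] f) -> smooth (S n) f.
Proof.
  intros Hf; induction n as [|n IH]; intros H.
  - apply smooth_S; split; [exact Hf | apply smooth_0].
  - assert (K : smooth (S n) f) by (apply IH; eapply smooth_le; [|exact H]; lia).
    apply smooth_S; split; [exact Hf|].
    replace (Cderiv f) with (fun x => diffop [m] f x + m * f x).
    + apply smooth_lin; assumption.
    + apply functional_extensionality; intros x; simpl; Cring.
Qed.

(** By [smooth_of_diffop], each factor of the product adds one derivative,
    starting from the zero function. *)
Lemma Espace_smooth mu f n : Espace mu f -> smooth n f.
Proof.
  revert f n; induction mu as [|m mu IH] using rev_ind; intros f n H.
  - replace f with (fun _ : R => RtoC 0); [apply smooth_const|].
    apply functional_extensionality; intros x; symmetry; apply H.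
  - apply (smooth_le (S n)); [lia|]. apply (smooth_of_diffop m).
    + apply (proj1 H 0%nat); rewrite length_app; simpl; lia.
    + apply IH, Espace_diffop, H.
Qed.

(** The regularity demanded by the longer list comes from [Espace_smooth]. *)
Lemma Espace_app_right mu nu f : Espace nu f -> Espace (mu ++ nu) f.
Proof.
  intros H; split; [apply (Espace_smooth nu), H|].
  rewrite diffop_app.
  replace (diffop nu f) with (fun _ : R => RtoC 0)
    by (apply functional_extensionality; intros x; symmetry; apply H).
  induction mu as [|m mu IH]; intros x; [reflexivity|].
  rewrite diffop_cons.
  replace (diffop mu (fun _ => 0)) with (fun _ : R => RtoC 0)
    by (apply functional_extensionality; intros y; symmetry; apply IH).
  simpl; rewrite (has_Cderiv_unique _ _ _ (has_Cderiv_const 0 x)); Cring.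
Qed.

Lemma Cderiv_n_diffop_single k m f : smooth (S k) f ->
  Cderiv_n k (diffop [m] f) = (fun x => Cderiv_n (S k) f x + - m * Cderiv_n k f x).
Proof.
  intros H; rewrite diffop_single, Cderiv_n_lin.
  - rewrite Cderiv_n_S; reflexivity.
  - apply smooth_S, H.
  - eapply smooth_le; [|exact H]; lia.
Qed.

(** For the list mu ++ [m], the function D_m f lies in E(mu) and again has zero
    initial data, so it vanishes by induction; then f' = m f with f(0) = 0. *)
Lemma Espace_initial_unique mu f : Espace mu f ->
  (forall k, (k < length mu)%nat -> Cderiv_n k f 0%R = 0) -> f = (fun _ => 0).
Proof.
  revert f; induction mu as [|m mu IH] using rev_ind; intros f H H0.
  - apply functional_extensionality; intros x; apply H.
  - rewrite length_app in H0; simpl in H0.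
    assert (K : diffop [m] f = (fun _ => 0)).
    { apply IH; [apply Espace_diffop, H|]. intros k hk.
      rewrite Cderiv_n_diffop_single by apply (Espace_smooth _ _ _ H).
      rewrite !H0 by lia. Cring. }
    apply (first_order_unique m); [|apply (H0 0%nat); lia].
    intros x. eapply has_Cderiv_eq.
    + apply differentiable_has_Cderiv, (Espace_smooth _ _ 1 H 0%nat); lia.
    + transitivity (diffop [m] f x + m * f x); [simpl; Cring|]. rewrite K; Cring.
Qed.

(** * Fundamental functions *)

Lemma is_fundamental_unique mu f g :
  is_fundamental mu f -> is_fundamental mu g -> f = g.
Proof.
  intros [Ef [f0 f1]] [Eg [g0 g1]].
  assert (K : (fun x => f x + - (1) * g x) = (fun _ => 0)).
  { apply (Espace_initial_unique mu); [apply Espace_lin; assumption|].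
    intros k hk. rewrite Cderiv_n_lin by (eapply Espace_smooth; eassumption).
    destruct (Nat.eq_dec k (pred (length mu))) as [->|hk'].
    - rewrite f1, g1; Cring.
    - rewrite f0, g0 by lia; Cring. }
  apply functional_extensionality; intros x.
  apply (f_equal (fun h => h x)) in K; cbv beta in K.
  replace (f x) with (f x + - (1) * g x + g x) by Cring. rewrite K; Cring.
Qed.

(** The fundamental function of mu ++ [m] is the solution of D_m f = g with
    f(0) = 0, where g is that of mu: from f^(k+1)(0) = g^(k)(0) + m f^(k)(0), the
    initial data of g move up by one order. *)
Lemma is_fundamental_exists mu : mu <> [] -> exists f, is_fundamental mu f.
Proof.
  induction mu as [|m mu IH] using rev_ind; [congruence|]; intros _.
  (* Solving D_m f = g carries E(mu) into the space of the list mu ++ [m]. *)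
  assert (Hsolve : forall g f, Espace mu g ->
    (forall x, has_Cderiv f x (m * f x + g x)) ->
    Espace (mu ++ [m]) f /\ diffop [m] f = g).
  { intros g f Hg Hf.
    destruct (Cderiv_char _ _ Hf) as [H1 H2].
    assert (K : diffop [m] f = g).
    { rewrite diffop_single, H2; apply functional_extensionality; intros x; Cring. }
    split; [split|exact K].
    - rewrite length_app, Nat.add_comm; simpl.
      apply (smooth_of_diffop m); [exact H1|]. rewrite K; apply (Espace_smooth _ _ _ Hg).
    - rewrite diffop_app, K; apply Hg. }
  (* The zero function is not fundamental for the empty list, so a single exponent
     is treated apart, with f(0) = 1. *)
  destruct mu as [|m' mu'].
  - destruct (first_order_exists m 1 (fun _ => 0)) as [f [Hf H0]].
    { intros x; eexists; apply (has_Cderiv_const 0). }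
    exists f; split; [|split; [intros k hk; simpl in hk; lia | exact H0]].
    apply (Hsolve (fun _ => 0)); [|exact Hf].
    split; [intros k hk; simpl in hk; lia | reflexivity].
  - set (mu := m' :: mu') in *. destruct IH as [g [Eg [g0 g1]]]; [discriminate|].
    destruct (first_order_exists m 0 g) as [f [Hf H0]].
    { apply (Espace_smooth _ _ 1 Eg 0%nat); lia. }
    destruct (Hsolve g f Eg Hf) as [Ef Df].
    assert (Hrec : forall k, Cderiv_n (S k) f 0%R = Cderiv_n k g 0%R + m * Cderiv_n k f 0%R).
    { intros k; rewrite <- Df, Cderiv_n_diffop_single by apply (Espace_smooth _ _ _ Ef). Cring. }
    assert (Hz : forall k, (k < length mu)%nat -> Cderiv_n k f 0%R = 0).
    { induction k as [|k IHk]; intros hk; [exact H0|].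
      rewrite Hrec, IHk by lia. rewrite g0 by lia. Cring. }
    exists f; split; [exact Ef|]. rewrite length_app; simpl length.
    split.
    + intros k hk; apply Hz; unfold mu; simpl; lia.
    + replace (pred (S (length mu') + 1)) with (S (length mu')) by lia.
      rewrite Hrec, Hz by (unfold mu; simpl; lia).
      change (length mu') with (pred (length mu)). rewrite g1; Cring.
Qed.

Lemma the_fun_eq (P : (R -> C) -> Prop) f :
  P f -> (forall g, P g -> f = g) -> the_fun P = f.
Proof.
  intros Pf U. unfold the_fun.
  destruct (epsilon_spec (inhabits (fun _ : R => RtoC 0)) (unique P)) as [H1 H2].
  - exists f; split; assumption.
  - apply H2, Pf.
Qed.

Lemma Phi_eq mu f : is_fundamental mu f -> Phi mu = f.
Proof.
  intros H; apply the_fun_eq; [exact H|].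
  intros g Hg; apply (is_fundamental_unique mu); assumption.
Qed.

Lemma Phi_fundamental mu : mu <> [] -> is_fundamental mu (Phi mu).
Proof.
  intros H; destruct (is_fundamental_exists mu H) as [f Hf].
  rewrite (Phi_eq _ _ Hf); exact Hf.
Qed.

Lemma is_fundamental_diffop_single mu m f :
  mu <> [] -> is_fundamental (mu ++ [m]) f -> is_fundamental mu (diffop [m] f).
Proof.
  intros hmu [E [f0 f1]]. rewrite length_app in f0, f1; simpl in f0, f1.
  assert (hl : (0 < length mu)%nat) by (destruct mu; [congruence | simpl; lia]).
  split; [apply Espace_diffop, E|]; split; [intros k hk|];
    rewrite Cderiv_n_diffop_single by apply (Espace_smooth _ _ _ E).
  - rewrite !f0 by lia; Cring.
  - replace (pred (length mu + 1)) with (S (pred (length mu))) in f1 by lia.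
    rewrite f1, f0 by lia. Cring.
Qed.

(** In particular D_l0 D_l1 maps the fundamental function of
    (l2, l3, l0, l1) to that of (l2, l3). *)
Lemma diffop_Phi_app mu nu : mu <> [] -> diffop nu (Phi (mu ++ nu)) = Phi mu.
Proof.
  intros hmu; symmetry; apply Phi_eq.
  assert (H : is_fundamental (mu ++ nu) (Phi (mu ++ nu))).
  { apply Phi_fundamental; destruct mu; [congruence | discriminate]. }
  revert H; generalize (Phi (mu ++ nu)) as f.
  induction nu as [|m nu IH] using rev_ind; intros f H.
  - rewrite app_nil_r in H; exact H.
  - rewrite diffop_app; apply IH, is_fundamental_diffop_single.
    + destruct mu; [congruence | discriminate].
    + rewrite <- app_assoc; exact H.
Qed.

Lemma Phi_perm mu nu : mu <> [] -> Permutation mu nu -> Phi mu = Phi nu.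
Proof.
  intros hmu H; symmetry; apply Phi_eq.
  destruct (Phi_fundamental mu hmu) as [E [f0 f1]].
  split; [apply (Espace_perm mu); assumption|].
  rewrite <- (Permutation_length H); split; assumption.
Qed.

Lemma Phi_pair a b :
  Espace [a; b] (Phi [a; b]) /\ Phi [a; b] 0%R = 0 /\ Cderiv (Phi [a; b]) 0%R = 1.
Proof.
  destruct (Phi_fundamental [a; b]) as [E [f0 f1]]; [discriminate|].
  split; [exact E|]; split; [apply (f0 0%nat); simpl; lia | exact f1].
Qed.

(** * Boundary value problems at two points *)

(** Translated to g with g(0) = 0, the function is g'(0) Phi by
    [Espace_initial_unique]; its value at q - p then gives g'(0) = 0. *)
Lemma two_point_unique a b p q f :
  Espace [a; b] f -> f p = 0 -> f q = 0 -> Phi [a; b] (q - p)%R <> 0 ->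
  f = (fun _ => 0).
Proof.
  intros E fp fq hq.
  destruct (Phi_pair a b) as [EP [P0 P1]].
  set (g := fun x => f (x - - p)%R).
  assert (Eg : Espace [a; b] g) by apply (Espace_shift _ f), E.
  assert (g0 : g 0%R = 0) by (unfold g; rewrite <- fp; f_equal; ring).
  assert (gq : g (q - p)%R = 0) by (unfold g; rewrite <- fq; f_equal; ring).
  assert (K : (fun x => g x + - Cderiv g 0%R * Phi [a; b] x) = (fun _ => 0)).
  { apply (Espace_initial_unique [a; b]); [apply Espace_lin; assumption|].
    intros k hk; rewrite Cderiv_n_lin by (eapply Espace_smooth; eassumption).
    destruct k as [|[|k]]; simpl in hk; [| |lia]; simpl.
    - rewrite g0, P0; Cring.
    - rewrite P1; Cring. }
  assert (c0 : Cderiv g 0%R = 0).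
  { pose proof (f_equal (fun h => h (q - p)%R) K) as Kq; cbv beta in Kq.
    rewrite gq in Kq.
    replace (Cderiv g 0%R) with
      (- (0 + - Cderiv g 0%R * Phi [a; b] (q - p)%R) / Phi [a; b] (q - p)%R)
      by (field; exact hq).
    rewrite Kq; field; exact hq. }
  apply functional_extensionality; intros x.
  pose proof (f_equal (fun h => h (x - p)%R) K) as Kx; cbv beta in Kx.
  rewrite c0 in Kx. rewrite <- Kx. unfold g.
  replace (x - p - - p)%R with x by ring. Cring.
Qed.

(** If Phi vanished at - h, it would have the two zeros - h and 0, whose distance
    h is not a zero of Phi, and [two_point_unique] would make Phi zero. *)
Lemma Phi_pair_opp a b h : Phi [a; b] h <> 0 -> Phi [a; b] (- h)%R <> 0.
Proof.
  intros hh H. destruct (Phi_pair a b) as [EP [P0 P1]].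
  assert (K : Phi [a; b] = (fun _ => 0)).
  { apply (two_point_unique a b (- h) 0 _ EP H P0).
    replace (0 - - h)%R with h by ring; exact hh. }
  apply hh; rewrite K; reflexivity.
Qed.

(** The point where L_1 f = 1 comes second, whatever the order of p and q on the
    line; [B_one] and [A_one] differ only in that order. *)
Definition boundary_data (l0 l1 l2 l3 : C) (p q : R) (f : R -> C) : Prop :=
  Espace [l0; l1; l2; l3] f /\ f p = 0 /\ f q = 0 /\
  L_one l0 l1 f p = 0 /\ L_one l0 l1 f q = 1.

(** [two_point_unique] is applied twice to the difference: to its image under
    L_1, which lies in E(l2, l3), then to the difference in E(l0, l1). *)
Lemma boundary_data_unique l0 l1 l2 l3 p q f g :
  Phi [l0; l1] (q - p)%R <> 0 -> Phi [l2; l3] (q - p)%R <> 0 ->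
  boundary_data l0 l1 l2 l3 p q f -> boundary_data l0 l1 l2 l3 p q g -> f = g.
Proof.
  intros h01 h23 [Ef [fp [fq [Lfp Lfq]]]] [Eg [gp [gq [Lgp Lgq]]]].
  unfold L_one in *.
  set (d := fun x => f x + - (1) * g x).
  assert (Ed : Espace [l0; l1; l2; l3] d) by (apply Espace_lin; assumption).
  assert (Ld : diffop [l0; l1] d =
               (fun x => diffop [l0; l1] f x + - (1) * diffop [l0; l1] g x))
    by (apply diffop_lin; eapply Espace_smooth; eassumption).
  assert (K : diffop [l0; l1] d = (fun _ => 0)).
  { apply (two_point_unique l2 l3 p q); [| | |exact h23].
    - apply (Espace_diffop [l2; l3] [l0; l1]).
      apply (Espace_perm [l0; l1; l2; l3]); [|exact Ed].
      apply (Permutation_app_comm [l0; l1] [l2; l3]).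
    - rewrite Ld, Lfp, Lgp; Cring.
    - rewrite Ld, Lfq, Lgq; Cring. }
  assert (d0 : d = (fun _ => 0)).
  { apply (two_point_unique l0 l1 p q); [| | |exact h01].
    - split; [apply (Espace_smooth _ _ _ Ed)|]. intros x; rewrite K; reflexivity.
    - unfold d; rewrite fp, gp; Cring.
    - unfold d; rewrite fq, gq; Cring. }
  apply functional_extensionality; intros x.
  apply (f_equal (fun h => h x)) in d0; unfold d in d0; cbv beta in d0.
  replace (f x) with (f x + - (1) * g x + g x) by Cring. rewrite d0; Cring.
Qed.

(** The witness is Phi4(x - p) / Phi23(h) - sigma(h) Phi01(x - p) with h = q - p,
    a combination in which L_1 sees only the first term. *)
Lemma boundary_data_exists l0 l1 l2 l3 p q :
  Phi [l0; l1] (q - p)%R <> 0 -> Phi [l2; l3] (q - p)%R <> 0 ->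
  exists f, boundary_data l0 l1 l2 l3 p q f /\
    Cderiv f p = - sigma_L l0 l1 l2 l3 (q - p)%R /\
    Cderiv f q = rho_L l0 l1 l2 l3 (q - p)%R.
Proof.
  intros h01 h23.
  set (mu := [l0; l1; l2; l3]) in *.
  assert (hperm : Permutation ([l2; l3] ++ [l0; l1]) mu)
    by apply (Permutation_app_comm [l2; l3] [l0; l1]).
  destruct (Phi_fundamental mu) as [E4 [F0 _]]; [discriminate|].
  assert (z0 : Phi mu 0%R = 0) by (apply (F0 0%nat); simpl; lia).
  assert (z1 : Cderiv (Phi mu) 0%R = 0) by (apply (F0 1%nat); simpl; lia).
  destruct (Phi_pair l0 l1) as [E01 [u0 u1]].
  destruct (Phi_pair l2 l3) as [_ [v0 _]].
  assert (L4 : diffop [l0; l1] (Phi mu) = Phi [l2; l3]).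
  { rewrite <- (Phi_perm ([l2; l3] ++ [l0; l1]) mu) by (discriminate || exact hperm).
    apply diffop_Phi_app; discriminate. }
  set (P4 := fun x => Phi mu (x - p)%R).
  set (P2 := fun x => Phi [l0; l1] (x - p)%R).
  assert (EP4 : Espace mu P4) by apply (Espace_shift _ (Phi mu)), E4.
  assert (EP2 : Espace mu P2).
  { apply (Espace_shift _ (Phi [l0; l1])), (Espace_perm _ _ _ hperm).
    apply Espace_app_right, E01. }
  assert (E0 : Espace mu (fun _ => 0)).
  { apply (Espace_app_right mu []). split; [apply smooth_0 | reflexivity]. }
  set (a := / Phi [l2; l3] (q - p)%R).
  set (s := sigma_L l0 l1 l2 l3 (q - p)%R).
  (* The summand 0 makes this a linear combination, as in [Espace_lin]. *)
  set (g := fun x => 0 + a * P4 x).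
  assert (Eg : Espace mu g) by (apply (Espace_lin mu (fun _ => 0)); assumption).
  exists (fun x => g x + - s * P2 x).
  assert (HL : forall x, diffop [l0; l1] (fun x => g x + - s * P2 x) x
                         = a * Phi [l2; l3] (x - p)%R).
  { intros x.
    rewrite diffop_lin by (eapply Espace_smooth; eassumption).
    unfold g; rewrite (diffop_lin _ (fun _ => 0)) by (eapply Espace_smooth; eassumption).
    unfold P4, P2.
    rewrite !diffop_shift by (eapply Espace_smooth; eassumption).
    rewrite L4, (proj2 E01).
    replace (diffop [l0; l1] (fun _ => 0) x) with (RtoC 0); [Cring|].
    symmetry; apply (Espace_app_right [l0; l1] []).
    split; [apply smooth_0 | reflexivity]. }
  assert (HD : forall x, Cderiv (fun x => g x + - s * P2 x) x
      = a * Cderiv (Phi mu) (x - p)%R + - s * Cderiv (Phi [l0; l1]) (x - p)%R).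
  { assert (D4 : differentiable (Phi mu)) by apply (proj1 E4 0%nat (Nat.lt_0_succ _)).
    assert (D2 : differentiable (Phi [l0; l1])) by apply (proj1 E01 0%nat (Nat.lt_0_succ _)).
    intros x; apply has_Cderiv_unique.
    eapply has_Cderiv_eq.
    - apply has_Cderiv_lin; [apply has_Cderiv_lin; [apply has_Cderiv_const|]|];
        apply has_Cderiv_shift, differentiable_has_Cderiv; assumption.
    - Cring. }
  assert (pp : (p - p)%R = 0%R) by ring.
  split; [split; [|split; [|split; [|split]]]|split].
  - apply Espace_lin; assumption.
  - unfold g, P4, P2; rewrite pp, z0, u0; Cring.
  - unfold g, P4, P2, a, s, sigma_L. fold mu. field. split; assumption.
  - unfold L_one; rewrite HL, pp, v0; Cring.
  - unfold L_one; rewrite HL. unfold a; field; assumption.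
  - rewrite HD, pp, z1, u1. Cring.
  - rewrite HD. unfold a, s, sigma_L, rho_L. fold mu. field. split; assumption.
Qed.

(** * The entries of R *)

(** Here (p, q) = (t_{j+1}, t_j), whence the negative step and the appeal to
    [Phi_pair_opp]. *)
Lemma Cderiv_A_one l0 l1 l2 l3 t j :
  Phi [l0; l1] (t (j + 1)%nat - t j)%R <> 0 -> Phi [l2; l3] (t (j + 1)%nat - t j)%R <> 0 ->
  Cderiv (A_one l0 l1 l2 l3 t j) (t j) = rho_L l0 l1 l2 l3 (- (t (j + 1)%nat - t j))%R /\
  Cderiv (A_one l0 l1 l2 l3 t j) (t (j + 1)%nat)
    = - sigma_L l0 l1 l2 l3 (- (t (j + 1)%nat - t j))%R.
Proof.
  intros h01 h23. apply Phi_pair_opp in h01, h23.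
  rewrite Ropp_minus_distr in *.
  destruct (boundary_data_exists l0 l1 l2 l3 _ _ h01 h23) as [f [Hf [H1 H2]]].
  replace (A_one l0 l1 l2 l3 t j) with f; [split; assumption|].
  symmetry; apply the_fun_eq.
  - destruct Hf as [E [fp [fq [Lp Lq]]]]; repeat split; assumption || apply E.
  - intros g [E [gp [gq [Lp Lq]]]].
    apply (boundary_data_unique l0 l1 l2 l3 _ _ f g h01 h23 Hf).
    repeat split; assumption || apply E.
Qed.

Lemma Cderiv_B_one l0 l1 l2 l3 t j :
  Phi [l0; l1] (t (j + 1)%nat - t j)%R <> 0 -> Phi [l2; l3] (t (j + 1)%nat - t j)%R <> 0 ->
  Cderiv (B_one l0 l1 l2 l3 t j) (t j) = - sigma_L l0 l1 l2 l3 (t (j + 1)%nat - t j)%R /\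
  Cderiv (B_one l0 l1 l2 l3 t j) (t (j + 1)%nat)
    = rho_L l0 l1 l2 l3 (t (j + 1)%nat - t j)%R.
Proof.
  intros h01 h23.
  destruct (boundary_data_exists l0 l1 l2 l3 _ _ h01 h23) as [f [Hf [H1 H2]]].
  replace (B_one l0 l1 l2 l3 t j) with f; [split; assumption|].
  symmetry; apply the_fun_eq; [exact Hf|].
  intros g Hg; exact (boundary_data_unique l0 l1 l2 l3 _ _ f g h01 h23 Hf Hg).
Qed.

Lemma Rentry_Rcoef l0 l1 l2 l3 n t i j :
  (2 <= i <= n - 1)%nat -> (2 <= j <= n - 1)%nat ->
  Rentry l0 l1 l2 l3 n t i j = Rcoef l0 l1 l2 l3 t i j.
Proof.
  intros hi hj. unfold Rentry, Rmat.
  rewrite coeff_mat_bij by lia. f_equal; lia.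
Qed.

Theorem theorem12 (l0 l1 l2 l3 : C) (n : nat) (t : nat -> R)
  (hn : (3 <= n)%nat)
  (ht : forall j : nat, (1 <= j <= n - 1)%nat -> (t j < t (j + 1)%nat)%R)
  (h01 : forall j : nat, (1 <= j <= n - 1)%nat ->
     Phi [l0; l1] (t (j + 1)%nat - t j)%R <> 0)
  (h23 : forall j : nat, (1 <= j <= n - 1)%nat ->
     Phi [l2; l3] (t (j + 1)%nat - t j)%R <> 0) :
  (forall j : nat, (2 <= j <= n - 1)%nat ->
     Rentry l0 l1 l2 l3 n t j j =
       rho_L l0 l1 l2 l3 (t j - t (j - 1)%nat)%R
       - rho_L l0 l1 l2 l3 (- (t (j + 1)%nat - t j))%R) /\
  (forall j : nat, (2 <= j <= n - 2)%nat ->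
     Rentry l0 l1 l2 l3 n t j (j + 1) =
       sigma_L l0 l1 l2 l3 (t (j + 1)%nat - t j)%R /\
     Rentry l0 l1 l2 l3 n t (j + 1) j =
       - sigma_L l0 l1 l2 l3 (- (t (j + 1)%nat - t j))%R).
Proof.
  split; intros j hj; [|split]; rewrite Rentry_Rcoef by lia; unfold Rcoef.
  - rewrite Nat.eqb_refl.
    destruct (Cderiv_A_one l0 l1 l2 l3 t j) as [-> _]; [apply h01; lia | apply h23; lia|].
    destruct (Cderiv_B_one l0 l1 l2 l3 t (j - 1)) as [_ HB];
      [apply h01; lia | apply h23; lia|].
    replace (j - 1 + 1)%nat with j in HB by lia. rewrite HB; reflexivity.
  - rewrite (proj2 (Nat.eqb_neq (j + 1) j)) by lia. rewrite Nat.eqb_refl.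
    destruct (Cderiv_B_one l0 l1 l2 l3 t j) as [-> _]; [apply h01; lia | apply h23; lia|].
    Cring.
  - rewrite (proj2 (Nat.eqb_neq j (j + 1))), (proj2 (Nat.eqb_neq j (j + 1 + 1))) by lia.
    rewrite Nat.eqb_refl. replace (j + 1 - 1)%nat with j by lia.
    apply Cderiv_A_one; [apply h01; lia | apply h23; lia].
Qed.
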